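(* Let $\ell\ge1$ and let $\sigma_i=e^{\frac{\pi\imath}{\ell+1}}\,S_i\in SL_{\ell+1}(\mathbb C)$, $1\le i\le\ell$, where $S_i$ is the permutation matrix of the transposition $(i\;i+1)$. The group $\widetilde W(A_\ell)$ generated by $\sigma_1,\dots,\sigma_\ell$ provides a central extension $$1\longrightarrow\mathcal Z(SL_{\ell+1})\longrightarrow\widetilde W(A_\ell)\longrightarrow W(A_\ell)\longrightarrow1$$ of the Weyl group $W(A_\ell)$ by the center of $SL_{\ell+1}(\mathbb C)$, with the defining relations $$\sigma_k^2=\zeta\quad\text{for each }1\le k\le\ell;\qquad \sigma_k\sigma_j=\sigma_j\sigma_k\ \text{ if } m_{kj}=2;\qquad \sigma_k\sigma_j\sigma_k=\sigma_j\sigma_k\sigma_j\ \text{ if } m_{kj}=3,$$ where $\zeta$ is the generator of the center $\mathcal Z(SL_{\ell+1})$ described in the context (so $\zeta^{\ell+1}=1$). The group $\widetilde W(A_\ell)$ embeds in the normalizer $N_{SL_{\ell+1}}(H_{SL_{\ell+1}})$ compatibly with the exact sequence $$1\longrightarrow H_{SL_{\ell+1}}\longrightarrow N_{SL_{\ell+1}}(H_{SL_{\ell+1}})\longrightarrow W(A_\ell)\longrightarrow1$$ and the embedding $\mathcal Z(SL_{\ell+1})\subset H_{SL_{\ell+1}}$.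
   Context: $H_{SL_{\ell+1}}$ is the diagonal maximal torus of $SL_{\ell+1}(\mathbb C)$; $W(A_\ell)=\mathfrak S_{\ell+1}$ is the Weyl group. $m_{kj}=2$ if $|k-j|>1$ and $m_{kj}=3$ if $|k-j|=1$. $\zeta=e^{2\pi\imath\varpi_\ell^\vee}=e^{\frac{2\pi\imath}{\ell+1}}\mathrm{Id}_{\ell+1}$, where $\varpi_\ell^\vee$ is the last fundamental coweight; it generates $\mathcal Z(SL_{\ell+1}(\mathbb C))\simeq\mathbb Z/(\ell+1)\mathbb Z$. *)

(* Defs.v *)
From HB Require Import structures.
From mathcomp Require Import all_boot all_order all_algebra all_fingroup.
From mathcomp Require Import all_classical all_reals all_analysis.
From mathcomp Require Import complex.

Set Implicit Arguments.
Unset Strict Implicit.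
Unset Printing Implicit Defensive.

Import Order.TTheory GRing.Theory Num.Theory GroupScope.

Local Open Scope classical_set_scope.
Local Open Scope group_scope.

Section Groups.
Variable G : groupType.

Definition subgroup (H : set G) : Prop :=
  H 1 /\ forall x y, H x -> H y -> H (x * y^-1).

Definition generated_subgroup (A : set G) : set G := smallest subgroup A.

Definition group_center (H : set G) : set G :=
  [set z | H z /\ forall x, H x -> commute z x].

Definition group_normalizer (H : set G) : set G :=
  [set g | [set x ^ g | x in H] = H].

(* 1 -> A -> B -> W -> 1, for subgroups A, B of an ambient group G: the first
   map is the inclusion and the second is the restriction of p to B (the values
   of p outside B are irrelevant). *)
Definition short_exact (W : groupType) (A B : set G) (p : G -> W) : Prop :=
  [/\ subgroup A, subgroup B,
      forall x y, B x -> B y -> p (x * y) = p x * p y,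
      A = [set x | B x /\ p x = 1]
    & [set p x | x in B] = setT].

Definition central_extension (W : groupType) (A B : set G) (p : G -> W) : Prop :=
  short_exact A B p /\ A `<=` group_center B.

End Groups.

Section Presentations.
Variable X : Type.

(* (x, false) is the letter x and (x, true) its formal inverse. *)
Definition word := seq (X * bool).

Definition letter (x : X) : X * bool := (x, false).

(* Equality in the group <X | u = v for rel u v>: the smallest congruence on
   words containing rel and free cancellation. *)
Inductive word_eq (rel : word -> word -> Prop) : word -> word -> Prop :=
| word_eq_rel u v : rel u v -> word_eq rel u v
| word_eq_cancel x b : word_eq rel [:: (x, b); (x, ~~ b)] [::]
| word_eq_refl u : word_eq rel u u
| word_eq_sym u v : word_eq rel u v -> word_eq rel v u
| word_eq_trans u v w : word_eq rel u v -> word_eq rel v w -> word_eq rel u w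
| word_eq_cat u u' v v' :
    word_eq rel u u' -> word_eq rel v v' -> word_eq rel (u ++ v) (u' ++ v').

Definition eval_word (G : groupType) (s : X -> G) (w : word) : G :=
  \prod_(a <- w) (if a.2 then (s a.1)^-1 else s a.1).

(* The map from <X | rel> induced by s is a well-defined isomorphism onto B. *)
Definition presented_by (G : groupType) (B : set G) (s : X -> G)
    (rel : word -> word -> Prop) : Prop :=
  B = generated_subgroup (range s) /\
  forall u v, word_eq rel u v <-> eval_word s u = eval_word s v.

End Presentations.

Section SpecialLinear.
Local Open Scope ring_scope.
Variables (F : fieldType) (n : nat).

Record SL := MkSL { SL_mx :> 'M[F]_n; _ : \det SL_mx == 1 }.

HB.instance Definition _ := [isSub for SL_mx].
HB.instance Definition _ := [Choice of SL by <:].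

Lemma det_SL (g : SL) : \det g = 1. Proof. by case: g => A /= /eqP. Qed.

Lemma SL_unit (g : SL) : (g : 'M[F]_n) \in unitmx.
Proof. by rewrite unitmxE det_SL unitr1. Qed.

Fact SL_one_subproof : \det (1%:M : 'M[F]_n) == 1. Proof. by rewrite det1. Qed.
Fact SL_mul_subproof (g h : SL) : \det (g *m h) == 1.
Proof. by rewrite det_mulmx !det_SL mulr1. Qed.
Fact SL_inv_subproof (g : SL) : \det (invmx g) == 1.
Proof. by rewrite det_inv det_SL invr1. Qed.

Definition SL_one := MkSL SL_one_subproof.
Definition SL_mul g h := MkSL (SL_mul_subproof g h).
Definition SL_inv g := MkSL (SL_inv_subproof g).

Fact SL_mulA : associative SL_mul.
Proof. by move=> a b c; apply: val_inj; rewrite /= mulmxA. Qed.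
Fact SL_mul1 : left_id SL_one SL_mul.
Proof. by move=> a; apply: val_inj; rewrite /= mul1mx. Qed.
Fact SL_mul1r : right_id SL_one SL_mul.
Proof. by move=> a; apply: val_inj; rewrite /= mulmx1. Qed.
Fact SL_mulV : left_inverse SL_one SL_inv SL_mul.
Proof. by move=> a; apply: val_inj; rewrite /= mulVmx ?SL_unit. Qed.
Fact SL_mulVr : right_inverse SL_one SL_inv SL_mul.
Proof. by move=> a; apply: val_inj; rewrite /= mulmxV ?SL_unit. Qed.

HB.instance Definition _ :=
  isGroup.Build SL SL_mulA SL_mul1 SL_mul1r SL_mulV SL_mulVr.

Definition torus : set SL := [set g | is_diag_mx (g : 'M[F]_n)].

End SpecialLinear.

Arguments torus : clear implicits.

Section Tits.
Local Open Scope ring_scope.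
Variables (R : realType) (l : nat).

(* e^(i t) *)
Definition cis (t : R) : R[i] := Complex (cos t) (sin t).

Lemma cisX (t : R) (m : nat) : cis t ^+ m = cis (t *+ m).
Proof.
elim: m => [|m IH]; first by rewrite expr0 mulr0n /cis cos0 sin0.
rewrite exprS IH mulrS /cis cosD sinD; apply/eqP.
by rewrite eq_complex /= eqxx addrC eqxx.
Qed.

(* The simple reflection (k+1 k+2) in 1-based notation: here
   k : 'I_l starts at 0. *)
Definition simple_refl (k : 'I_l) : 'S_l.+1 := tperm (inord k) (inord k.+1).

Definition sigma_mx (k : 'I_l) : 'M[R[i]]_l.+1 :=
  cis (pi / l.+1%:R) *: perm_mx (simple_refl k).

Fact sigma_subproof k : \det (sigma_mx k) == 1.
Proof.
have pil : pi / l.+1%:R *+ l.+1 = pi :> R by rewrite -mulr_natr divfK ?pnatr_eq0.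
rewrite detZ cisX pil det_perm odd_tperm.
have -> /= : inord k != inord k.+1 :> 'I_l.+1.
  have lk := ltn_ord k.
  by rewrite -val_eqE /= !inordK ?ltnS ?(ltnW lk) // neq_ltn ltnSn.
rewrite expr1 /cis cospi sinpi mulrN1; apply/eqP.
by apply/eqP; rewrite eq_complex /= opprK oppr0 !eqxx.
Qed.

Definition sigma k : SL R[i] l.+1 := MkSL (sigma_subproof k).

Fact zeta_subproof :
  \det ((cis (2 * pi / l.+1%:R))%:M : 'M[R[i]]_l.+1) == 1.
Proof.
have pil : 2 * pi / l.+1%:R *+ l.+1 = 2 * pi :> R.
  by rewrite -mulr_natr divfK ?pnatr_eq0.
by rewrite det_scalar cisX pil /cis mulr_natl cos2pi sin2pi.
Qed.

Definition zeta : SL R[i] l.+1 := MkSL zeta_subproof.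

Definition Wtilde : set (SL R[i] l.+1) := generated_subgroup (range sigma).

(* Coxeter matrix of type A_l *)
Definition cox_m (k j : 'I_l) : nat :=
  if k == j then 1%N else if (k.+1 == j) || (j.+1 == k) then 3%N else 2%N.

Inductive Wgen : Type := gen_sigma of 'I_l | gen_zeta.

Definition Wgen_val (x : Wgen) : SL R[i] l.+1 :=
  match x with gen_sigma k => sigma k | gen_zeta => zeta end.

Let s k := letter (gen_sigma k).
Let z := letter gen_zeta.

Inductive Wrel : word Wgen -> word Wgen -> Prop :=
| Wrel_zeta : Wrel (nseq l.+1 z) [::]
| Wrel_square k : Wrel [:: s k; s k] [:: z]
| Wrel_commute k j : cox_m k j = 2%N -> Wrel [:: s k; s j] [:: s j; s k]
| Wrel_braid k j : cox_m k j = 3%N ->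
    Wrel [:: s k; s j; s k] [:: s j; s k; s j].

(* q is the canonical projection of the normalizer of the torus to the Weyl
   group, acting on the torus by permutation of the diagonal entries. In the
   MathComp convention (s * t) i = t (s i), this makes q multiplicative. *)
Definition weyl_action (q : SL R[i] l.+1 -> 'S_l.+1) : Prop :=
  forall g h, group_normalizer (torus R[i] l.+1) g -> torus R[i] l.+1 h ->
  forall i, (g * h * g^-1)%g i i = h (q g i) (q g i).

End Tits.

Arguments Wtilde : clear implicits.

(* Main.v *)
(* An element g of SL normalizes the torus iff it is monomial, as is seen by
   conjugating a torus element with pairwise distinct entries; the projection of
   N to the Weyl group sends g to the permutation underlying its nonzero entries.
   Elements of the group generated by the sigma_k are multiples of permutation
   matrices, so those over the identity are scalar matrices of determinant 1,
   that is, powers of zeta.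

   For the relations, let G be the abstract group with generators s_k and z. By
   induction on m, every product of s_0, ..., s_m and z can be rewritten as
   u s_m s_(m-1) ... s_j with u a product of s_0, ..., s_(m-1) and z. If the
   underlying permutation is trivial, then, since that of u fixes m+1 and that of
   the tail sends m+1 to j, the tail is empty. Hence the kernel of G -> S_(l+1)
   consists of powers of z, and z^(l+1) = 1 matches the order of zeta. *)
Require Import Defs.
From HB Require Import structures.
From mathcomp Require Import all_boot all_order all_algebra all_fingroup.
From mathcomp Require Import all_classical all_reals all_analysis.
From mathcomp Require Import complex.
From mathcomp Require Import zify ring lra.
Import Order.TTheory GRing.Theory Num.Theory.
Local Open Scope classical_set_scope.
Local Open Scope group_scope.

(** * Groups given by presentations *)

Section Presented.
Context {X : Type} (r : word X -> word X -> Prop).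

(** [{classic _}] and [asbool] provide the choice type and the boolean relation that [eq_quot]
    requires, for an arbitrary [X] and a [Prop]-valued congruence. *)
Definition wordb : rel {classic word X} := fun u v => `[< word_eq r u v >].

Fact wordb_refl : reflexive wordb.
Proof. by move=> u; apply/asboolP/word_eq_refl. Qed.

Fact wordb_sym : symmetric wordb.
Proof. by move=> u v; apply/asboolP/asboolP => /word_eq_sym. Qed.

Fact wordb_trans : transitive wordb.
Proof.
by move=> v u w /asboolP uv /asboolP vw; apply/asboolP/(word_eq_trans uv vw).
Qed.

Canonical wordb_equiv := EquivRel wordb wordb_refl wordb_sym wordb_trans.

Definition presented := {eq_quot wordb}%qT.

HB.instance Definition _ := Choice.on presented.

Definition word_class (u : word X) : presented := (\pi_presented u)%qT.

Lemma class_eq u v : word_class u = word_class v <-> word_eq r u v.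
Proof.
split=> [/eqquotP /asboolP // | uv].
by apply/eqquotP/asboolP.
Qed.

Lemma class_ind (P : presented -> Prop) : (forall u, P (word_class u)) -> forall x, P x.
Proof. by move=> Pu; elim/quotW. Qed.

Definition inv_word (w : word X) : word X := rev [seq (a.1, ~~ a.2) | a <- w].

Lemma inv_wordK : involutive inv_word.
Proof.
move=> w; rewrite /inv_word map_rev revK -map_comp.
by elim: w => //= -[x b] w ->; rewrite negbK.
Qed.

Lemma word_eq_mulV w : word_eq r (w ++ inv_word w) [::].
Proof.
elim/last_ind: w => [|w [x b] IH]; first exact: word_eq_refl.
rewrite /inv_word map_rcons rev_rcons cat_rcons -(cat1s (x, b)).
apply: word_eq_trans IH; apply: word_eq_cat; first exact: word_eq_refl.
rewrite -[_ :: rev _]cat1s -[X in word_eq _ _ X]cat0s catA.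
by apply: word_eq_cat; [exact: word_eq_cancel|exact: word_eq_refl].
Qed.

(** The congruence has no rule for inversion. The inverses are compared through u^-1 = u^-1 (u v^-1)
    = v^-1, where u v^-1 reduces to v v^-1 by hypothesis, hence to the empty word. *)
Lemma word_eq_inv u v : word_eq r u v -> word_eq r (inv_word u) (inv_word v).
Proof.
move=> uv; have Vuu : word_eq r (inv_word u ++ u) [::].
  by rewrite -{2}[u]inv_wordK; exact: word_eq_mulV.
rewrite -[inv_word u]cats0; apply: word_eq_trans (_ : word_eq r _ (inv_word u ++ (u ++ inv_word v))) _.
  apply: word_eq_cat; [exact: word_eq_refl|apply: word_eq_sym].
  apply: word_eq_trans (word_eq_mulV v); apply: word_eq_cat => //.
  exact: word_eq_refl.
by rewrite catA; apply: (word_eq_cat Vuu); exact: word_eq_refl.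
Qed.

Let repr_class u : word_eq r (generic_quotient.repr (word_class u)) u.
Proof. by apply/class_eq; rewrite /word_class reprK. Qed.

Definition presented_mul (x y : presented) := word_class (generic_quotient.repr x ++ generic_quotient.repr y).
Definition presented_inv (x : presented) := word_class (inv_word (generic_quotient.repr x)).

Fact class_mul u v : presented_mul (word_class u) (word_class v) = word_class (u ++ v).
Proof. by apply/class_eq/word_eq_cat; exact: repr_class. Qed.

Fact class_inv u : presented_inv (word_class u) = word_class (inv_word u).
Proof. by apply/class_eq/word_eq_inv/repr_class. Qed.

Fact presented_mulA : associative presented_mul.
Proof.
elim/class_ind=> u; elim/class_ind=> v; elim/class_ind=> w.
by rewrite !class_mul catA.
Qed.

Fact presented_mul1 : left_id (word_class [::]) presented_mul.
Proof. by elim/class_ind=> u; rewrite class_mul. Qed.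

Fact presented_mul1r : right_id (word_class [::]) presented_mul.
Proof. by elim/class_ind=> u; rewrite class_mul cats0. Qed.

Fact presented_mulV : left_inverse (word_class [::]) presented_inv presented_mul.
Proof.
elim/class_ind=> u; rewrite class_inv class_mul; apply/class_eq.
by rewrite -{2}[u]inv_wordK; exact: word_eq_mulV.
Qed.

Fact presented_mulVr : right_inverse (word_class [::]) presented_inv presented_mul.
Proof.
elim/class_ind=> u; rewrite class_inv class_mul; apply/class_eq.
exact: word_eq_mulV.
Qed.

HB.instance Definition _ := isGroup.Build presented
  presented_mulA presented_mul1 presented_mul1r presented_mulV presented_mulVr.

Lemma word_classM u v : word_class (u ++ v) = word_class u * word_class v.
Proof. by rewrite -class_mul. Qed.

Lemma word_classV u : word_class (inv_word u) = (word_class u)^-1.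
Proof. by rewrite -class_inv. Qed.

(** At the tautological generators, evaluation is the quotient map, so computations with evaluated
    words in [presented r] translate back into [word_eq]. *)
Lemma eval_word_class w : eval_word (fun x => word_class [:: (x, false)]) w = word_class w.
Proof.
rewrite /eval_word; elim: w => [|[x b] w IH]; first by rewrite big_nil.
rewrite big_cons IH -(cat1s _ w) word_classM; apply: (congr1 (fun g => g * _)).
by case: b; rewrite //= -word_classV.
Qed.

End Presented.

(** * Evaluation of words in a group *)

Section EvalWord.
Context {X : Type} {G : groupType} (s : X -> G).

Lemma eval_word_cat u v : eval_word s (u ++ v) = eval_word s u * eval_word s v.
Proof. exact: big_cat. Qed.

Lemma eval_word1 x : eval_word s [:: letter x] = s x.
Proof. exact: big_seq1. Qed.

Lemma eval_word_nseq m x : eval_word s (nseq m (letter x)) = s x ^+ m.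
Proof.
elim: m => [|m IH]; first by rewrite /eval_word big_nil.
by rewrite -[nseq _ _]cat1s eval_word_cat IH eval_word1 expgS.
Qed.

Lemma eval_word_rcons w a :
  eval_word s (rcons w a) = eval_word s w * eval_word s [:: a].
Proof. by rewrite -cats1 eval_word_cat. Qed.

Lemma eval_word_sound (r : word X -> word X -> Prop) :
  (forall u v, r u v -> eval_word s u = eval_word s v) ->
  forall u v, word_eq r u v -> eval_word s u = eval_word s v.
Proof.
move=> rs u v; elim=> [||||{}u {}v w _ -> _ ->|] //.
  move=> x b; rewrite /eval_word !big_cons big_nil mulg1.
  by case: b; rewrite /= ?mulVg ?mulgV.
by move=> ? ? ? ? _ IH _ IH'; rewrite !eval_word_cat IH IH'.
Qed.

(** Completeness is needed only at the identity: if u and v have the same value, then u v^-1 has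
    value 1, and the division is undone in the group [presented r]. *)
Lemma presented_byP (B : set G) (r : word X -> word X -> Prop) :
  B = generated_subgroup (range s) ->
  (forall u v, r u v -> eval_word s u = eval_word s v) ->
  (forall w, eval_word s w = 1 -> word_eq r w [::]) ->
  presented_by B s r.
Proof.
move=> BE rs r1; split=> // u v; split; first exact: eval_word_sound.
have sV w : eval_word s (inv_word w) = (eval_word s w)^-1.
  apply/esym/mulg1_eq; rewrite -eval_word_cat.
  by rewrite (eval_word_sound r rs _ _ (word_eq_mulV r w)) /eval_word big_nil.
move=> uv; apply/class_eq/divg1_eq; rewrite -word_classV -word_classM.
by apply/class_eq/r1; rewrite eval_word_cat sV uv mulgV.
Qed.

End EvalWord.

Lemma eval_word_morph {X : Type} {G H : groupType} (f : G -> H) (s : X -> G) w :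
  {morph f : x y / x * y} ->
  f (eval_word s w) = eval_word (fun x => f (s x)) w.
Proof.
move=> fM; have f1 : f 1 = 1 by apply: (mulgI (f 1)); rewrite -fM !mulg1.
have fV x : f x^-1 = (f x)^-1 by apply/esym/mulg1_eq; rewrite -fM mulgV.
rewrite /eval_word; elim: w => [|[x b] w IH]; first by rewrite !big_nil.
by rewrite !big_cons fM IH; case: b; rewrite /= ?fV.
Qed.

(** * The type A relations *)

Section BraidGroups.
Context {G : groupType} (l : nat) (s : nat -> G) (z : G).
Hypothesis s_square : forall k, k < l -> s k * s k = z.
Hypothesis s_comm : forall k j, k.+1 < j -> j < l -> commute (s k) (s j).
Hypothesis s_braid : forall k, k.+1 < l ->
  s k * s k.+1 * s k = s k.+1 * s k * s k.+1.

Lemma z_comm k : k < l -> commute z (s k).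
Proof. by move=> kl; rewrite -(s_square _ kl) /commute mulgA. Qed.

(** This is s_(j+d-1) ... s_(j+1) s_j, with d factors. Indexing by natural numbers keeps shifts of
    the index free of ordinals. *)
Fixpoint run (j d : nat) : G := if d is d'.+1 then s (j + d') * run j d' else 1.

Lemma run_commute x j d :
  (forall i, j <= i < j + d -> commute x (s i)) -> commute x (run j d).
Proof.
elim: d => [_|d IH xs] /=; first exact: commute1.
apply: commuteM; first by apply: xs; rewrite leq_addr addnS ltnSn.
by apply: IH => i /andP[ji id]; apply: xs; rewrite ji addnS ltnS ltnW.
Qed.

Lemma run_extend j d : run j d.+1 = run j.+1 d * s j.
Proof.
elim: d => [|d IH]; first by rewrite /= addn0 mulg1 mul1g.
by rewrite /= -/(run j d.+1) IH mulgA addSnnS.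
Qed.

(** Going left, s_(k+1) commutes with s_j, ..., s_(k-1) and meets s_(k+1) s_k. The braid relation
    turns s_(k+1) s_k s_(k+1) into s_k s_(k+1) s_k, and the leading s_k commutes with all larger
    factors. *)
Lemma run_shift j d k : j + d <= l -> j <= k -> k.+1 < j + d ->
  run j d * s k.+1 = s k * run j d.
Proof.
elim: d => [|d IH]; first by rewrite addn0 => _ jk kj; lia.
rewrite addnS => jdl jk; rewrite ltnS leq_eqVlt => /orP[/eqP kjd|kjd] /=.
  case: d => [|d] in kjd IH jdl *; first by lia.
  have {}kjd : j + d = k by lia.
  rewrite /= addnS kjd -!mulgA -(run_commute (s k.+1)); last first.
    by move=> i ij; apply/commute_sym/s_comm; lia.
  rewrite !mulgA; congr (_ * _); rewrite s_braid //; lia.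
rewrite -mulgA IH ?(ltnW jdl) // !mulgA; congr (_ * _).
by apply/commute_sym/s_comm; lia.
Qed.

(** The submonoid generated by z and the s_k with k < m. Inverses are left out: once z has finite
    order, they are positive words. *)
Inductive reach (m : nat) : G -> Prop :=
| reach1 : reach m 1
| reach_s g k : k < m -> reach m g -> reach m (g * s k)
| reach_z g : reach m g -> reach m (g * z).

(* The runs [s_m s_(m-1) ... s_j] lift the minimal coset representatives of
   [S_(m+1)] in [S_(m+2)]. *)
Lemma reach_run m g : m < l -> reach m.+1 g ->
  exists u j d, [/\ reach m u, j + d = m.+1 & g = u * run j d].
Proof.
move=> ml; elim=> [|{}g k|{}g] => [|km _|_].
- by exists 1, m.+1, 0; split; rewrite ?addn0 ?mulg1 //; exact: reach1.
- case=> u [j [d [ru jd ->]]].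
  (* The effect of s_k depends on its position: for k + 1 < j it passes into u, for k + 1 = j it
     lengthens the run, for k > j it crosses the run as s_(k-1), and for k = j it squares the last
     factor to z and shortens the run. *)
  have [kj|jk|kj] := ltngtP k j.
  + have [k1j|jk|k1j] := ltngtP k.+1 j; [|lia|].
    * exists (u * s k), j, d; split=> //; first by apply: reach_s => //; lia.
      rewrite -!mulgA; congr (_ * _); apply/commute_sym/run_commute => i ij.
      by apply: s_comm; lia.
    * exists u, k, d.+1; split=> //; first lia.
      by rewrite run_extend k1j mulgA.
  + case: k => [|k] // in km jk *; exists (u * s k), j, d; split => //.
      by apply: reach_s.
    by rewrite -!mulgA run_shift //; lia.
  + subst k; case: d => [|d] in jd *; first lia.
    exists (u * z), j.+1, d; split; [exact: reach_z|lia|].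
    rewrite run_extend -!mulgA s_square; last lia.
    by rewrite (run_commute z) // => i ij; apply: z_comm; lia.
- case=> u [j [d [ru jd ->]]]; exists (u * z), j, d; split=> //.
    exact: reach_z.
  by rewrite -!mulgA (run_commute z) // => i ij; apply: z_comm; lia.
Qed.

Lemma reach_ker (p : G -> 'S_l.+1) :
  {morph p : x y / x * y} -> p z = 1 ->
  (forall k, k < l -> p (s k) = tperm (inord k) (inord k.+1)) ->
  forall g, reach l g -> p g = 1 -> exists a, g = z ^+ a.
Proof.
move=> pM pz ps g; have p1 : p 1 = 1.
  by apply: (mulgI (p 1)); rewrite -pM !mulg1.
have inordE i : i <= l -> (inord i : 'I_l.+1) = i :> nat by move=> il; rewrite inordK.
(* The s_k with k < m move only the points 0, ..., m. *)
have pfix m u i : m < i -> i <= l -> reach m u -> p u (inord i) = inord i.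
  move=> mi il; elim=> [|{}u k km _ IH|{}u _ IH]; rewrite ?p1 ?perm1 ?pM //.
    rewrite permM IH ps ?tpermD //; try lia.
      by rewrite -val_eqE /= !inordE; lia.
    by rewrite -val_eqE /= !inordE; lia.
  by rewrite permM IH pz perm1.
(* Permutations compose from left to right, so the factors of the run lower the point j + d one unit
   at a time down to j. *)
have prun j d : j + d <= l -> p (run j d) (inord (j + d)) = inord j.
  elim: d => [|d IH]; first by rewrite addn0 p1 perm1.
  move=> jdl; rewrite pM permM ps ?addnS ?tpermR ?IH //; lia.
(* The induction lowers the bound in [reach] while p keeps its values in the fixed group S_(l+1), so
   m is separated from l. *)
have [m ml] : exists m, m = l by exists l.
rewrite -[X in reach X](ml); have {ml} : m <= l by rewrite ml.
elim: m g => [|m IH] g ml rg pg.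
  by elim: rg => [|//|_ _ [a ->]]; [exists 0|exists a.+1; rewrite expgSr].
have [u [j [d [ru jd gE]]]] := reach_run _ _ ml rg.
have jm : j = m.+1.
  have := prun j d; rewrite jd => /(_ ml); rewrite -{1}(pfix m u m.+1) //.
  rewrite -permM -pM -gE pg perm1 => /(congr1 val) /=; rewrite !inordE //; lia.
apply: (IH g (ltnW ml) _ pg).
have d0 : d = 0 by lia.
by rewrite gE d0 mulg1.
Qed.

End BraidGroups.

(** * Adjacent transpositions in the symmetric group *)

Section SimpleReflections.
Context {l : nat}.
Implicit Types k j : 'I_l.

Lemma cox_m_sym k j : cox_m k j = cox_m j k.
Proof. by rewrite /cox_m eq_sym orbC. Qed.

Lemma simple_refl_commute k j : cox_m k j = 2 ->
  commute (simple_refl k) (simple_refl j).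
Proof.
rewrite /cox_m; case: eqP => // /eqP kj; case: ifP => // /norP[k1j j1k] _.
have [kl jl] := (ltn_ord k, ltn_ord j); move: kj k1j j1k; rewrite -val_eqE /=.
move=> kj k1j j1k; rewrite /commute conjgC; congr (_ * _).
rewrite tpermJ !tpermD // -val_eqE /= !inordK; lia.
Qed.

Lemma simple_refl_braid k j : cox_m k j = 3 ->
  simple_refl k * simple_refl j * simple_refl k =
  simple_refl j * simple_refl k * simple_refl j.
Proof.
wlog k1j : k j / k.+1 == j.
  move=> th c3; have : (k.+1 == j) || (j.+1 == k).
    by move: c3; rewrite /cox_m; case: eqP => //; case: ifP.
  by case/orP=> kj; [|apply/esym]; apply: th => //; rewrite cox_m_sym.
have kl : k.+1 < l by rewrite (eqP k1j).
(* Both sides are conjugates of one adjacent transposition by another, and both equal the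
   transposition of k and k + 2. *)
have conjE a b : simple_refl a * simple_refl b * simple_refl a =
    simple_refl b ^ (simple_refl a : 'S_l.+1).
  by rewrite conjgE tpermV mulgA.
move=> _; rewrite !conjE !tpermJ.
rewrite /simple_refl -(eqP k1j) tpermL tpermR !tpermD // -?val_eqE /= ?inordK; lia.
Qed.

End SimpleReflections.

(** For d > 0, the transposition of a and a + d + 1 is the conjugate of that of a and a + d by the
    adjacent one of a + d and a + d + 1. Transpositions generate the symmetric group. *)
Lemma adjacent_tperm_ind l (P : 'S_l.+1 -> Prop) :
  P 1 -> (forall s t, P s -> P t -> P (s * t)) ->
  (forall k : 'I_l, P (simple_refl k)) -> forall s, P s.
Proof.
move=> P1 PM Pt.
have PJ a d : a + d <= l -> P (tperm (inord a) (inord (a + d))).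
  elim: d => [|d IH] adl; first by rewrite addn0 tperm1.
  have adl' : a + d < l by lia.
  have Pad := Pt (Ordinal adl'); rewrite /simple_refl /= -addnS in Pad.
  have [d0|d_gt0] := posnP d; first by move: Pad; rewrite d0 addn0.
  have -> : tperm (inord a) (inord (a + d.+1)) =
      tperm (inord (a + d)) (inord (a + d.+1)) * tperm (inord a) (inord (a + d)) *
      tperm (inord (a + d)) (inord (a + d.+1)) :> 'S_l.+1.
    rewrite -mulgA -{1}[tperm (inord (a + d)) _]tpermV -[RHS]conjgE tpermJ tpermL tpermD //.
      by rewrite -val_eqE /= !inordK; lia.
    by rewrite -val_eqE /= !inordK; lia.
  by apply: (PM _ _ _ Pad); apply: (PM _ _ Pad); apply: IH; lia.
have Ptperm a b : P (tperm a b).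
  wlog ab : a b / a <= b.
    by move=> th; have [/th //|/ltnW /th] := leqP a b; rewrite tpermC.
  rewrite -[a]inord_val -[b]inord_val -(subnKC ab); apply: PJ.
  by have := ltn_ord b; lia.
move=> s; have [ts -> _] := prod_tpermP s.
by elim: ts => [|t ts IH]; rewrite ?big_nil // big_cons; apply: PM.
Qed.

(** * Monomial matrices and the normalizer of the torus *)

Section GroupSets.
Context {G : groupType}.
Implicit Types (A H : set G).

Lemma subgroup1 {H} : subgroup H -> H 1. Proof. by case. Qed.

Lemma subgroupV {H x} : subgroup H -> H x -> H x^-1.
Proof. by case=> H1 HV Hx; rewrite -[x^-1]mul1g; apply: HV. Qed.

Lemma subgroupM {H x y} : subgroup H -> H x -> H y -> H (x * y).
Proof.
by move=> HG Hx /(subgroupV HG) Hy; rewrite -[y]invgK; apply: HG.2.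
Qed.

Lemma subgroupX {H x} n : subgroup H -> H x -> H (x ^+ n).
Proof.
move=> HG Hx; elim: n => [|n IH]; first exact: (subgroup1 HG).
by rewrite expgS; apply: (subgroupM HG).
Qed.

Lemma generated_subgroupP A : subgroup (generated_subgroup A).
Proof.
split=> [B [[]//]|x y Ax Ay B BA].
by apply: BA.1.2; [exact: Ax|exact: Ay].
Qed.

(** Both directions are required: in an infinite group, conjugation by g can map H into a proper
    subset of itself. *)
Lemma group_normalizerP H g : group_normalizer H g <->
  (forall h, H h -> H (h ^ g)) /\ (forall h, H h -> H (h ^ g^-1)).
Proof.
split=> [Hg|[Hg HVg]].
  split=> h Hh; first by rewrite -Hg; exists h.
  by move: Hh; rewrite -{1}Hg => -[x Hx <-]; rewrite conjgK.
rewrite /group_normalizer /=; apply/seteqP; split=> [_ [x Hx <-]|x Hx].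
  exact: Hg.
by exists (x ^ g^-1); rewrite ?conjgKV //; apply: HVg.
Qed.

Lemma group_normalizer_subgroup H : subgroup (group_normalizer H).
Proof.
split=> [|x y /group_normalizerP[Hx HVx] /group_normalizerP[Hy HVy]].
  by apply/group_normalizerP; split=> h; rewrite ?invg1 conjg1.
apply/group_normalizerP; split=> h Hh.
  by rewrite conjgM; apply/HVy/Hx.
by rewrite invgF conjgM; apply/HVx/Hy.
Qed.

End GroupSets.

Section Monomial.
Context {F : fieldType} {n : nat}.
Implicit Types (g h : SL F n) (s t : 'S_n).
Local Open Scope ring_scope.

(** Only the vanishing of the other entries is imposed; the entry at (i, s i) is nonzero because the
    determinant is 1. *)
Definition monomial g s := forall i j, g i j != 0 -> j = s i.

Lemma SL_mulE g h : (g * h)%g = (g : 'M[F]_n) *m h :> 'M[F]_n.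
Proof. by []. Qed.

Lemma SL_row_neq0 g i : exists j, g i j != 0.
Proof.
apply: contrapT => /forallNP g0.
have := det_SL g; rewrite (expand_det_row _ i) big1 => [/esym/eqP|j _].
  by rewrite oner_eq0.
by have /negP/negPn/eqP-> := g0 j; rewrite mul0r.
Qed.

Lemma monomial_neq0 g s i : monomial g s -> g i (s i) != 0.
Proof. by move=> gs; have [j gij] := SL_row_neq0 g i; rewrite -(gs _ _ gij). Qed.

Lemma monomial_inj {g s t} : monomial g s -> monomial g t -> s = t.
Proof.
by move=> gs gt; apply/permP=> i; have /gt := monomial_neq0 g s i gs.
Qed.

Lemma monomial_mulE {g s} (B : 'M[F]_n) i k :
  monomial g s -> ((g : 'M[F]_n) *m B) i k = g i (s i) * B (s i) k.
Proof.
move=> gs; rewrite mxE (bigD1 (s i)) //= big1 ?addr0 // => j.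
by have [->|/gs ->] := eqVneq (g i j) 0; rewrite ?mul0r ?eqxx.
Qed.

Lemma monomialM g h s t : monomial g s -> monomial h t -> monomial (g * h)%g (s * t)%g.
Proof.
move=> gs ht i k; rewrite SL_mulE (monomial_mulE _ _ _ gs) mulf_eq0 permM.
by case/norP=> _ /ht.
Qed.

(** Row s^-1 a of g g^-1 = 1 is a nonzero multiple of row a of g^-1. *)
Lemma monomialV g s : monomial g s -> monomial g^-1%g s^-1%g.
Proof.
move=> gs a b gab; have := congr1 (fun h : SL F n => h (s^-1 a)%g b) (mulgV g).
rewrite [LHS](monomial_mulE _ _ _ gs) permKV [RHS]mxE.
case: eqP => [->//|_] /eqP; rewrite mulf_eq0 (negPf gab) orbF.
by move=> /negPn; rewrite -{2}[a](permKV s) monomial_neq0.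
Qed.

Lemma torusP g : torus F n g <-> monomial g 1%g.
Proof.
split=> [/is_diag_mxP gd i j|g1].
  by rewrite perm1; apply: contra_neq_eq => ?; rewrite gd // eq_sym.
apply/is_diag_mxP=> i j ij; apply/eqP/negPn/negP => /g1 ji.
by rewrite ji perm1 eqxx in ij.
Qed.

Lemma torus_mulr g h i j : torus F n h -> (g * h)%g i j = g i j * h j j.
Proof.
move=> /is_diag_mxP hd; rewrite SL_mulE mxE (bigD1 j) //= big1 ?addr0 // => k kj.
by rewrite hd ?mulr0.
Qed.

Lemma torus_mull g h i j : torus F n h -> (h * g)%g i j = h i i * g i j.
Proof. by move=> /torusP h1; rewrite SL_mulE (monomial_mulE _ _ _ h1) perm1. Qed.

Lemma torus_subgroup : subgroup (torus F n).
Proof.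
split=> [|g h /torusP g1 /torusP h1]; apply/torusP.
  by move=> i j; rewrite perm1 mxE; have [->|] := eqVneq i j; rewrite ?eqxx.
by rewrite -[1%g](mulgV 1%g); apply/monomialM/monomialV.
Qed.

Lemma monomial_conj g s h :
  monomial g s -> torus F n h -> torus F n (g * h * g^-1)%g.
Proof.
move=> gs /torusP h1; apply/torusP; rewrite -(mulgV s) -{1}[s]mulg1.
by apply: monomialM; [exact: monomialM|exact: monomialV].
Qed.

Lemma monomial_conjE g s h i : monomial g s -> torus F n h ->
  (g * h * g^-1)%g i i = h (s i) (s i).
Proof.
(* Compare the entries at (i, s i) in (g h g^-1) g = g h. *)
move=> gs Hh; apply: (mulIf (monomial_neq0 g s i gs)).
by rewrite -torus_mull ?mulgVK ?torus_mulr 1?mulrC //; exact: monomial_conj gs Hh.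
Qed.

Lemma monomial_normalizer g s : monomial g s -> group_normalizer (torus F n) g.
Proof.
move=> gs; apply/group_normalizerP; split=> h Hh; rewrite conjgE mulgA.
  by rewrite -[X in (_ * X)%g]invgK; apply: monomial_conj Hh; exact: monomialV gs.
by rewrite invgK; exact: monomial_conj gs Hh.
Qed.

(* A torus element with distinct entries [h j j]: comparing [(g h g^-1) g] with
   [g h] entrywise shows that all nonzero entries of a row of [g] lie in the same
   column. *)
Lemma normalizer_monomial h g : torus F n h -> injective (fun i => h i i) ->
  group_normalizer (torus F n) g -> exists s, monomial g s.
Proof.
move=> Hh hI /group_normalizerP[/(_ h Hh) Hhg /(_ h Hh) HhVg].
have rowE i j : g i j != 0 -> h j j = (h ^ g^-1)%g i i.
  move=> gij; apply: (mulfI gij); rewrite -torus_mulr // mulrC -torus_mull //.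
  by rewrite conjgE invgK mulgA mulgVK.
(* The same comparison in g (g^-1 h g) = h g controls the columns, which makes the choice [f] of a
   nonzero entry in each row injective. *)
have colE i j : g i j != 0 -> h i i = (h ^ g)%g j j.
  move=> gij; apply: (mulfI gij); rewrite -torus_mulr // mulrC -torus_mull //.
  by rewrite conjgE mulVKg.
pose f i := sval (cid (SL_row_neq0 g i)).
have gf i : g i (f i) != 0 by rewrite /f; case: cid.
have fI : injective f.
  by move=> i i' fE; apply: hI; rewrite (colE _ _ (gf i)) (colE _ _ (gf i')) fE.
exists (perm fI) => i j gij; rewrite permE; apply: hI.
by rewrite (rowE _ _ gij) (rowE _ _ (gf i)).
Qed.

Lemma SL_scalar_central g a :
  (g : 'M[F]_n) = a%:M -> group_center [set: SL F n] g.
Proof.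
move=> ga; split=> // h _; apply: val_inj; rewrite /= ga.
by rewrite scalar_mxC.
Qed.

End Monomial.

(** * The extension of the Weyl group *)

Section TitsExtension.
Context {R : realType} {l : nat}.
Local Notation SLn := (SL R[i] l.+1).
Local Notation H := (torus R[i] l.+1).
Local Notation ze := (zeta R l).
Local Notation W := (Wtilde R l).
Implicit Types (g h w : SLn) (s t : 'S_l.+1) (k j : 'I_l).
Local Open Scope ring_scope.

Lemma cisM (x y : R) : cis x * cis y = cis (x + y).
Proof. by apply/eqP; rewrite eq_complex /= cosD sinD eqxx addrC eqxx. Qed.

Lemma cis_double_neq1 (x : R) : 0 < x < pi -> cis (x *+ 2) != 1.
Proof.
move=> /sin_gt0_pi x0; rewrite eq_complex /= negb_and; apply/orP; left.
rewrite cos_mulr2n cos2sin2 lt_eqF //.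
by have := exprn_gt0 2 x0; lra.
Qed.

Lemma zeta_primitive :
  l.+1.-primitive_root (cis (2 * pi / l.+1%:R) : R[i]).
Proof.
apply/andP; split=> //; apply/forallP=> i; rewrite unity_rootE cisX.
have l0 : l.+1%:R != 0 :> R by rewrite pnatr_eq0.
apply/eqP; have [il|il] := eqVneq i.+1 l.+1.
  rewrite il -[X in cis X]mulr_natr divfK // mulr_natl.
  by rewrite eq_complex /= cos2pi sin2pi !eqxx.
(* Half of the angle is pi (i + 1) / (l + 1), which lies strictly between 0 and pi when i + 1 < l +
   1. *)
apply/negbTE; have -> : 2 * pi / l.+1%:R *+ i.+1 = (pi * (i.+1%:R / l.+1%:R)) *+ 2 :> R.
  by rewrite -[LHS]mulr_natr -[RHS]mulr_natr; field.
apply: cis_double_neq1; rewrite mulr_gt0 ?pi_gt0 ?divr_gt0 ?ltr0n //=.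
rewrite gtr_pMr ?pi_gt0 // ltr_pdivrMr ?ltr0n // mul1r ltr_nat.
by rewrite ltn_neqAle il ltn_ord.
Qed.

(** Entries proportional to 1, ..., l + 1 are distinct; the factor a with a^(l+1) = 1 / (l+1)! gives
    determinant 1. *)
Lemma torus_regular_elt : exists2 h, H h & injective (fun i => h i i).
Proof.
pose a : R[i] := l.+1.-root ((l.+1)`!%:R)^-1.
pose d := \row_(i < l.+1) (a * i.+1%:R).
have a_n : a ^+ l.+1 = ((l.+1)`!%:R)^-1 by rewrite rootCK.
have fact0 : (l.+1)`!%:R != 0 :> R[i] by rewrite pnatr_eq0 -lt0n fact_gt0.
have a0 : a != 0.
  by apply: contra_eq_neq a_n => ->; rewrite expr0n /= eq_sym invr_neq0.
have det1 : \det (diag_mx d) == 1.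
  rewrite det_diag; under eq_bigr do rewrite mxE.
  rewrite big_split /= prodr_const card_ord a_n -natr_prod.
  suff -> : (\prod_(i < l.+1) i.+1)%N = l.+1`! by rewrite mulVf.
  by rewrite fact_prod big_add1 big_mkord.
exists (MkSL det1); first exact: diag_mx_is_diag.
move=> i j /=; rewrite !mxE !eqxx !mulr1n => /(mulfI a0) /eqP.
by rewrite eqr_nat => /eqP [/val_inj].
Qed.

Lemma normalizer_torusP g :
  group_normalizer H g <-> exists s, monomial g s.
Proof.
split=> [|[s gs]]; last exact: monomial_normalizer gs.
have [h Hh hI] := torus_regular_elt.
exact: normalizer_monomial Hh hI.
Qed.

Definition scaled_perm (a : R[i]) s w := (w : 'M[R[i]]_l.+1) = a *: perm_mx s.

Lemma scaled_perm_monomial a s w : scaled_perm a s w -> monomial w s.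
Proof.
move=> wE i j; rewrite wE !mxE; have [->//|] := eqVneq (s i) j.
by rewrite mulr0 eqxx.
Qed.

Lemma scaled_permM a b s t g h : scaled_perm a s g -> scaled_perm b t h ->
  scaled_perm (a * b) (s * t)%g (g * h)%g.
Proof.
move=> gE hE.
by rewrite /scaled_perm SL_mulE gE hE -scalemxAl -scalemxAr scalerA perm_mxM.
Qed.

Lemma scaled_perm_id a w : scaled_perm a 1%g w <-> (w : 'M[R[i]]_l.+1) = a%:M.
Proof. by rewrite /scaled_perm perm_mx1 scalemx1. Qed.

Lemma scaled_perm_inj {a s g h} : scaled_perm a s g -> scaled_perm a s h -> g = h.
Proof. by move=> gE hE; apply: val_inj; rewrite /= gE hE. Qed.

Lemma scaled_permV a s g : scaled_perm a s g -> scaled_perm a^-1 s^-1%g g^-1%g.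
Proof.
move=> gE; have a0 : a != 0.
  have := monomial_neq0 g s ord0 (scaled_perm_monomial _ _ _ gE).
  by rewrite gE mxE mulf_eq0 negb_or => /andP[].
have gV : (g : 'M[R[i]]_l.+1) *m (a^-1 *: perm_mx s^-1%g) = 1%:M.
  by rewrite gE -scalemxAl -scalemxAr scalerA -perm_mxM mulgV perm_mx1 divff // scale1r.
by rewrite /scaled_perm -[RHS]mul1mx -(mulVmx (SL_unit g)) -mulmxA gV mulmx1.
Qed.

Lemma scaled_perm_sigma k :
  scaled_perm (cis (pi / l.+1%:R)) (simple_refl k) (sigma R k).
Proof. by []. Qed.

Lemma scaled_perm_zeta : scaled_perm (cis (2 * pi / l.+1%:R)) 1%g ze.
Proof. exact/scaled_perm_id. Qed.

Lemma sigma_square k : (sigma R k * sigma R k)%g = ze.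
Proof.
have := scaled_permM _ _ _ _ _ _ (scaled_perm_sigma k) (scaled_perm_sigma k).
rewrite tperm2 cisM => ss; apply: (scaled_perm_inj ss).
have -> : pi / l.+1%:R + pi / l.+1%:R = 2 * pi / l.+1%:R :> R.
  by rewrite -mulrDl mulr_natl.
exact: scaled_perm_zeta.
Qed.

Lemma sigma_commute k j : cox_m k j = 2%N -> commute (sigma R k) (sigma R j).
Proof.
move=> /simple_refl_commute tkj.
have := scaled_permM _ _ _ _ _ _ (scaled_perm_sigma k) (scaled_perm_sigma j).
by rewrite tkj => /scaled_perm_inj; apply; exact: scaled_permM.
Qed.

Lemma sigma_braid k j : cox_m k j = 3%N ->
  (sigma R k * sigma R j * sigma R k = sigma R j * sigma R k * sigma R j)%g.
Proof.
move=> /simple_refl_braid tkj.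
have sss a b := scaled_permM _ _ _ _ _ _ (scaled_permM _ _ _ _ _ _
  (scaled_perm_sigma a) (scaled_perm_sigma b)) (scaled_perm_sigma a).
by have := sss k j; rewrite tkj => /scaled_perm_inj; apply; exact: sss.
Qed.

Lemma zetaX_mx m :
  (ze ^+ m)%g = (cis (2 * pi / l.+1%:R) ^+ m)%:M :> 'M[R[i]]_l.+1.
Proof.
elim: m => [|m IH]; first by rewrite expr0.
by rewrite expgS SL_mulE IH mul_scalar_mx scale_scalar_mx exprS.
Qed.

Lemma zetaX_eq1 m : (ze ^+ m)%g = 1%g <-> (l.+1 %| m)%N.
Proof.
rewrite (prim_order_dvd zeta_primitive); split=> [zm|/eqP zm].
  have /matrixP/(_ ord0 ord0) := zetaX_mx m.
  by rewrite zm !mxE !eqxx !mulr1n => <-.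
by apply: val_inj; rewrite /= zetaX_mx zm.
Qed.

Lemma scalar_zetaX g a : (g : 'M[R[i]]_l.+1) = a%:M -> exists m, g = (ze ^+ m)%g.
Proof.
move=> gE; have an : a ^+ l.+1 = 1 by rewrite -det_scalar -gE det_SL.
have [m aE] := prim_rootP zeta_primitive an.
by exists m; apply: val_inj; rewrite /= gE aE zetaX_mx.
Qed.

(** Commuting with a regular torus element forces a central g to be diagonal, and commuting with
    sigma_k equates neighbouring diagonal entries. So g is scalar of determinant 1. *)
Lemma SL_centerP g :
  group_center [set: SLn] g <-> exists m, g = (ze ^+ m)%g.
Proof.
split=> [[_ gC]|[m ->]]; last exact: SL_scalar_central (zetaX_mx m).
have [h Hh hI] := torus_regular_elt.
have Hg : H g.
  apply/torusP=> i j gij; rewrite perm1; apply: hI; apply: (mulfI gij).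
  by rewrite -torus_mulr // gC // torus_mull // mulrC.
have gstep k : g (inord k.+1) (inord k.+1) = g (inord k) (inord k).
  have sk := scaled_perm_monomial _ _ _ (scaled_perm_sigma k).
  apply: (mulfI (monomial_neq0 _ _ (inord k) sk)).
  by rewrite [simple_refl k _]tpermL -torus_mulr // -gC // torus_mull // mulrC.
have g0 i : (i <= l)%N -> g (inord i) (inord i) = g ord0 ord0.
  elim: i => [_|i IH il]; last by rewrite (gstep (Ordinal il)) IH // ltnW.
  by congr (g _ _); apply: val_inj; rewrite /= inordK.
apply: (scalar_zetaX _ (g ord0 ord0)); apply/matrixP=> i j; rewrite mxE.
have [<-|ij] := eqVneq i j; last by move/is_diag_mxP: Hg => ->; rewrite ?mulr0n.
by rewrite mulr1n -(g0 i) ?inord_val // -ltnS.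
Qed.

Lemma SL_center_generated :
  group_center [set: SLn] = generated_subgroup [set ze].
Proof.
apply/seteqP; split=> g.
  move=> /SL_centerP[m ->]; apply: (subgroupX _ (generated_subgroupP _)).
  exact: sub_gen_smallest.
apply: smallest_sub g; last by move=> _ ->; apply/SL_centerP; exists 1%N; rewrite expg1.
split=> [|x y [_ xC] [_ yC]]; first by apply/SL_centerP; exists 0%N.
split=> // h _; apply/commute_sym/commuteM; first by apply/commute_sym/xC.
by apply: commuteV; apply/commute_sym/yC.
Qed.

Lemma Wtilde_scaled_perm w : W w -> exists a s, scaled_perm a s w.
Proof.
suff : W `<=` [set w | exists a s, scaled_perm a s w] by apply.
apply: smallest_sub => [|_ [k _ <-]]; last first.
  by exists (cis (pi / l.+1%:R)), (simple_refl k).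
split=> [|x y [a [s xE]] [b [t yE]]].
  by exists 1, 1%g; apply/scaled_perm_id.
by exists (a * b^-1), (s * t^-1)%g; apply: scaled_permM (scaled_permV _ _ _ yE).
Qed.

Lemma Wtilde_sigma k : W (sigma R k).
Proof. by apply: sub_gen_smallest; exists k. Qed.

Lemma Wtilde_surj s : exists2 w, W w & monomial w s.
Proof.
have WG := generated_subgroupP (range (@sigma R l)).
apply: (adjacent_tperm_ind l (fun s => exists2 w, W w & monomial w s)) s.
- by exists 1%g; [exact: subgroup1|exact/torusP/subgroup1/torus_subgroup].
- move=> s t [g Wg gs] [h Wh ht]; exists (g * h)%g; first exact: (subgroupM WG).
  exact: monomialM.
- move=> k; exists (sigma R k); first exact: Wtilde_sigma.
  exact: scaled_perm_monomial (scaled_perm_sigma k).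
Qed.

Lemma Wtilde_zeta : (1 <= l)%N -> W ze.
Proof.
move=> l1; rewrite -(sigma_square (Ordinal l1)).
by apply: (subgroupM (generated_subgroupP _)); exact: Wtilde_sigma.
Qed.

End TitsExtension.

(** * Soundness and completeness of the relations *)

Section Presentation.
Context {R : realType} {l : nat}.
Local Notation z := (letter (gen_zeta l)).
Local Notation Q := (presented (@Wrel l)).

Lemma Wrel_eval u v : Wrel u v -> eval_word (@Wgen_val R l) u = eval_word (@Wgen_val R l) v.
Proof.
have ev2 (x y : Wgen l) : eval_word (@Wgen_val R l) [:: letter x; letter y] =
    Wgen_val R x * Wgen_val R y.
  by rewrite -cat1s eval_word_cat !eval_word1.
have ev3 (x y t : Wgen l) :
    eval_word (@Wgen_val R l) [:: letter x; letter y; letter t] =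
    Wgen_val R x * Wgen_val R y * Wgen_val R t.
  by rewrite -[X in eval_word _ X]/([:: _; _] ++ [:: _]) eval_word_cat ev2 eval_word1.
case=> [|k|k j kj|k j kj].
- by rewrite eval_word_nseq /eval_word big_nil; apply/zetaX_eq1.
- by rewrite ev2 eval_word1; exact: sigma_square.
- by rewrite !ev2; exact: sigma_commute.
- by rewrite !ev3; exact: sigma_braid.
Qed.

Definition Wgen_perm (x : Wgen l) : 'S_l.+1 :=
  if x is gen_sigma k then simple_refl k else 1.

Lemma eval_scaled_perm (w : word (Wgen l)) :
  exists a, scaled_perm a (eval_word Wgen_perm w) (eval_word (@Wgen_val R l) w).
Proof.
elim: w => [|[x b] w [a IH]].
  by exists 1%R; rewrite /eval_word !big_nil; apply/scaled_perm_id.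
have [c gen_x] : exists c, scaled_perm c (Wgen_perm x) (Wgen_val R x).
  case: x => [k|]; first by exists (cis (pi / l.+1%:R)%R); exact: scaled_perm_sigma.
  by exists (cis (2 * pi / l.+1%:R)%R); exact: scaled_perm_zeta.
rewrite /eval_word !big_cons; case: b => /=.
  by exists (c^-1 * a)%R; apply: scaled_permM IH; exact: scaled_permV.
by exists (c * a)%R; exact: scaled_permM.
Qed.

(* In the product with the symmetric group the second projection is a global
   morphism, so that [reach_ker] applies without constructing a morphism on [Q]. *)
Definition gen_pair (x : Wgen l) : Q * 'S_l.+1 :=
  (word_class _ [:: letter x], Wgen_perm x).

(** Extended by 1 beyond the range, to fit the generators indexed by natural numbers in [reach]. *)
Definition sigma_pair (k : nat) : Q * 'S_l.+1 :=
  if insub k is Some k' then gen_pair (gen_sigma k') else 1.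

Lemma sigma_pairE (k : 'I_l) : sigma_pair k = gen_pair (gen_sigma k).
Proof. by rewrite /sigma_pair valK. Qed.

Lemma sigma_pair_square k : (k < l)%N ->
  sigma_pair k * sigma_pair k = gen_pair (gen_zeta l).
Proof.
move=> kl; rewrite (sigma_pairE (Ordinal kl)); congr (_, _); last exact: tperm2.
by rewrite -word_classM; apply/class_eq/word_eq_rel/Wrel_square.
Qed.

Lemma sigma_pair_commute k j : (k.+1 < j)%N -> (j < l)%N ->
  commute (sigma_pair k) (sigma_pair j).
Proof.
move=> kj jl; have kl : (k < l)%N by lia.
have c2 : cox_m (Ordinal kl) (Ordinal jl) = 2.
  rewrite /cox_m -val_eqE /=; case: eqP => [|_]; first lia.
  by case: ifP => // /orP[] /eqP; lia.
rewrite (sigma_pairE (Ordinal kl)) (sigma_pairE (Ordinal jl)).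
congr (_, _); last exact: simple_refl_commute.
by rewrite -!word_classM; apply/class_eq/word_eq_rel/Wrel_commute.
Qed.

Lemma sigma_pair_braid k : (k.+1 < l)%N ->
  sigma_pair k * sigma_pair k.+1 * sigma_pair k =
  sigma_pair k.+1 * sigma_pair k * sigma_pair k.+1.
Proof.
move=> k1l; have kl := ltnW k1l.
have c3 : cox_m (Ordinal kl) (Ordinal k1l) = 3.
  by rewrite /cox_m -val_eqE /= eqxx; case: eqP => //; lia.
rewrite (sigma_pairE (Ordinal kl)) (sigma_pairE (Ordinal k1l)).
congr (_, _); last exact: simple_refl_braid.
have /class_eq := word_eq_rel (Wrel_braid c3).
by rewrite -!(cat1s _ (_ :: _)) !word_classM !mulgA.
Qed.

(** Inverse letters become positive words: z^(l+1) = 1 gives z^-1 = z^l, and then s_k^2 = z gives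
    s_k^-1 = s_k z^l. *)
Lemma reach_gen_pair w :
  reach sigma_pair (gen_pair (gen_zeta l)) l (eval_word gen_pair w).
Proof.
set s := sigma_pair; set zz := gen_pair _.
have reachX m g : reach s zz l g -> reach s zz l (g * zz ^+ m).
  elim: m => [|m IH] rg; first by rewrite mulg1.
  by rewrite expgSr mulgA; apply/reach_z/IH.
have zX : zz ^+ l.+1 = 1.
  suff zE m : zz ^+ m = (word_class _ (nseq m z), 1).
    by rewrite zE; congr (_, _); apply/class_eq/word_eq_rel/Wrel_zeta.
  elim: m => [//|m IH]; rewrite expgS IH; congr (_, _); last exact: mulg1.
  by rewrite -word_classM.
elim/last_ind: w => [|w [x b] IH]; first by rewrite /eval_word big_nil; exact: reach1.
rewrite eval_word_rcons; set g := eval_word _ w in IH *.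
have -> : eval_word gen_pair [:: (x, b)] = if b then (gen_pair x)^-1 else gen_pair x.
  exact: big_seq1.
case: x => [k|].
  rewrite -sigma_pairE -/s; have rgs : reach s zz l (g * s k) by exact: reach_s.
  case: b => //.
  have -> : (s k)^-1 = s k * zz ^+ l.
    apply: mulg1_eq; rewrite mulgA sigma_pair_square //.
    by rewrite -expgS zX.
  by rewrite mulgA; exact: reachX.
case: b; last exact: reach_z.
by have -> : zz^-1 = zz ^+ l; [apply: mulg1_eq; rewrite -expgS|exact: reachX].
Qed.

Lemma Wrel_complete w : eval_word (@Wgen_val R l) w = 1 -> word_eq (@Wrel l) w [::].
Proof.
(* The value of w is a multiple of the matrix of its permutation, and a monomial matrix determines
   its permutation. *)
move=> w1; have perm1w : eval_word Wgen_perm w = 1.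
  have [a /scaled_perm_monomial] := eval_scaled_perm w.
  rewrite w1 => /monomial_inj; apply; exact/torusP/subgroup1/torus_subgroup.
have fstw : (eval_word gen_pair w).1 = word_class _ w.
  by rewrite (eval_word_morph fst) // -[RHS]eval_word_class.
have sndw : (eval_word gen_pair w).2 = 1.
  by rewrite (eval_word_morph snd).
have [|m wE] := reach_ker l sigma_pair _ sigma_pair_square sigma_pair_commute
  sigma_pair_braid snd (fun _ _ => erefl) erefl _ _ (reach_gen_pair w) sndw.
  by move=> k kl; rewrite (sigma_pairE (Ordinal kl)).
have wz : word_eq (@Wrel l) w (nseq m z).
  apply/class_eq; rewrite -fstw wE; elim: m {wE} => [//|m IH].
  by rewrite expgS -[nseq _ _]cat1s word_classM -IH.
apply: (word_eq_trans wz).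
(* By soundness, w = z^m in the abstract group yields zeta^m = 1 in SL, so m is a multiple of l +
   1. *)
have /zetaX_eq1/dvdnP[q ->] : zeta R l ^+ m = 1.
  by rewrite -w1 (eval_word_sound _ _ Wrel_eval _ _ wz) eval_word_nseq.
elim: q => [|q IH]; first exact: word_eq_refl.
rewrite mulSn nseqD -[X in word_eq _ _ X]cat0s.
by apply: word_eq_cat IH; apply/word_eq_rel/Wrel_zeta.
Qed.

Lemma Wtilde_presented : (1 <= l)%N ->
  presented_by (Wtilde R l) (@Wgen_val R l) (@Wrel l).
Proof.
move=> l1; apply: presented_byP; [|exact: Wrel_eval|exact: Wrel_complete].
(* The presentation has the additional generator [gen_zeta]; since l >= 1, its value is the square
   of some sigma_k. *)
apply/seteqP; split; apply: smallest_sub; try exact: generated_subgroupP.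
  by move=> _ [k _ <-]; apply: sub_gen_smallest; exists (gen_sigma k).
by move=> _ [[k|] _ <-]; [exact: Wtilde_sigma|exact: Wtilde_zeta].
Qed.

End Presentation.

Theorem proposition8p1 (R : realType) (l : nat) (hl : (1 <= l)%N) :
  let SLn : set (SL R[i] l.+1) := setT in
  let Z := group_center SLn in
  let H := torus R[i] l.+1 in
  let N := group_normalizer H in
  let W := Wtilde R l in
  let ze := zeta R l in
  (* zeta generates the center, of order l + 1 *)
  Z = generated_subgroup [set ze] /\
  (forall m : nat, ze ^+ m = 1 <-> (l.+1 %| m)%N) /\
  (* relations *)
  (forall k : 'I_l, sigma R k ^+ 2 = ze) /\
  (forall k j : 'I_l, cox_m k j = 2 ->
     sigma R k * sigma R j = sigma R j * sigma R k) /\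
  (forall k j : 'I_l, cox_m k j = 3 ->
     sigma R k * sigma R j * sigma R k = sigma R j * sigma R k * sigma R j) /\
  (* which are defining *)
  presented_by W (@Wgen_val R l) (@Wrel l) /\
  (* the two extensions and their compatibility *)
  exists p q : SL R[i] l.+1 -> 'S_l.+1,
    [/\ central_extension Z W p,
        forall k : 'I_l, p (sigma R k) = simple_refl k,
        short_exact H N q,
        weyl_action q
      & [/\ W `<=` N, Z `<=` H & forall w, W w -> p w = q w]].
Proof.
move=> SLn Z H N W ze.
do 5![split; first by [exact: SL_center_generated|exact: zetaX_eq1
  |exact: sigma_square|exact: sigma_commute|exact: sigma_braid]].
split; first exact: Wtilde_presented.
(* The permutation underlying a monomial matrix, with the placeholder 1 off the normalizer;
   multiplicativity is claimed on N only. *)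
pose q (g : SL R[i] l.+1) : 'S_l.+1 :=
  if pselect (exists s, monomial g s) is left ex then sval (cid ex) else 1.
have qE g s : monomial g s -> q g = s.
  move=> gs; rewrite /q; case: pselect => [ex|[]]; last by exists s.
  by case: cid => t gt /=; exact: monomial_inj gt gs.
have qN g : N g -> monomial g (q g).
  by move=> /normalizer_torusP[s gs]; rewrite (qE g s).
have NG : subgroup N := group_normalizer_subgroup H.
have HG : subgroup H := torus_subgroup.
have WG : subgroup W := generated_subgroupP _.
have HN : H `<=` N by move=> h /torusP h1; exact: monomial_normalizer h1.
have WN : W `<=` N.
  by move=> w /Wtilde_scaled_perm[a [s /scaled_perm_monomial]]; exact: monomial_normalizer.
have ZW : Z `<=` W.
  by move=> z /SL_centerP[m ->]; apply: (subgroupX _ WG); exact: Wtilde_zeta.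
have ZE : Z = [set w | W w /\ q w = 1].
  apply/seteqP; split=> [z Zz|w /= [Ww qw]].
    split; first exact: ZW.
    case/SL_centerP: Zz => m ->; apply: (qE); apply/torusP.
    by rewrite /torus /= zetaX_mx scalar_mx_is_diag.
  have [a [s ws]] := Wtilde_scaled_perm w Ww.
  move: (ws); rewrite -(qE w s) ?qw; last exact: scaled_perm_monomial ws.
  by move=> /scaled_perm_id /SL_scalar_central.
have qM x y : N x -> N y -> q (x * y) = q x * q y.
  by move=> /qN xq /qN yq; apply: qE; exact: monomialM.
have ZG : subgroup Z by rewrite [Z]SL_center_generated; exact: generated_subgroupP.
have ZH : Z `<=` H.
  move=> z; rewrite ZE => -[/WN/qN + qz].
  by rewrite qz => /torusP.
(* The same map serves both extensions, which makes them compatible on W. *)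
exists q, q; split.
- split; last by move=> z Zz; split; [exact: ZW|move=> x _; exact: Zz.2].
  split=> //; first by move=> x y /WN Nx /WN Ny; exact: qM.
  apply/seteqP; split=> // s _; have [w Ww ws] := @Wtilde_surj R l s.
  by exists w => //; exact: qE.
- by move=> k; apply/qE/scaled_perm_monomial/scaled_perm_sigma.
- split=> //.
    apply/seteqP; split=> [h Hh|h /= [/qN + qh]]; last by rewrite qh => /torusP.
    by split; [exact: HN|exact/qE/torusP].
  apply/seteqP; split=> // s _; have [w Ww ws] := @Wtilde_surj R l s.
  by exists w; [exact: WN|exact: qE].
- by move=> g h /qN gq Hh i; exact: monomial_conjE.
- by split.
Qed.
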